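(* Let $\mathrm{GL}^a(n)$ be the parabolic contraction of $\mathrm{GL}(n,\mathbb F_q)$ with respect to the parabolic subgroup given by the segments $I_1,\dots,I_\ell$, and let $U^a=1+\mathfrak u^a$. For $u=1+X\in U^a$ (with $X\in\mathfrak u^a$) let $K(u)=\{1+AXB:\ A,B\in \mathrm{GL}^a(n)\}$. Then: 1) Each class $K(u)$, $u\in U^a$, contains the element $u_D$ for some rook placement $D\subset\Delta(\mathfrak u^a)$. 2) For rook placements $D,D'\subset \Delta(\mathfrak u^a)$, the elements $u_D$ and $u_{D'}$ belong to a common class if and only if $D$ and $D'$ are conjugate with respect to the left-right action of $W_L\times W_L$ on the set of roots $\Delta(\mathfrak u^a)$.
   Context: $\mathbb F_q$ is a finite field of $q$ elements of characteristic $\neq 2$. Write $[1,n]=I_1\sqcup\dots\sqcup I_\ell$ as a union of consecutive segments (in increasing order), $n_i=|I_i|$. All matrices are $n\times n$ over $\mathbb F_q$, with blocks $I_k\times I_m$. $\mathfrak p$ is the algebra of block upper triangular matrices, $\mathfrak u_+$ the strictly block upper triangular matrices, $L=\mathrm{GL}(n_1)\times\dots\times\mathrm{GL}(n_\ell)$ the block diagonal group. $\mathfrak u_-^a$ is the dual space $\mathfrak u_+^*$, identified with the space of strictly block lower triangular matrices via $\lambda(x)=\mathrm{Tr}(\lambda x)$. The associative algebra $\mathfrak{gl}^a(n)=\mathfrak p\oplus\mathfrak u_-^a$ has the matrix multiplication on $\mathfrak p$, zero multiplication on $\mathfrak u_-^a$, and $(t\lambda)(x)=\lambda(xt)$, $(\lambda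 t)(x)=\lambda(tx)$ for $t\in\mathfrak p$, $\lambda\in\mathfrak u^a_-$, $x\in\mathfrak u_+$ (equivalently, $t\lambda$ and $\lambda t$ are the strictly block lower triangular parts of the matrix products). The parabolic contraction $\mathrm{GL}^a(n)$ is the group of invertible elements of $\mathfrak{gl}^a(n)$. $\mathfrak u^a=\mathfrak u_+\oplus\mathfrak u_-^a$ is a nilpotent two-sided ideal and $U^a=1+\mathfrak u^a$. $\Delta(\mathfrak u^a)$ is the set of pairs (roots) $(i,j)\in I_k\times I_m$ with $k\ne m$. Those with $k<m$ are positive, with matrix unit $E_{(i,j)}\in\mathfrak u_+$; those with $k>m$ are negative, with matrix unit $F_{(i,j)}\in\mathfrak u_-^a$. A rook placement is a subset $D$ with at most one element in each row and each column; $D_\pm$ denotes its set of positive/negative elements. Put $X_D=\sum_{\gamma\in D_+}E_\gamma+\sum_{\gamma\in D_-}F_\gamma$ and $u_D=1+X_D$. $W_L=S_{I_1}\times\dots\times S_{I_\ell}$ is the Weyl group of $L$; $(w_1,w_2)\in W_L\times W_L$ acts on roots by $w_1(i,j)w_2=(w_1(i),w_2^{-1}(j))$. *)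

(* Defs.v *)
From HB Require Import structures.
From mathcomp Require Import all_boot all_order all_fingroup all_algebra.

Set Implicit Arguments.
Unset Strict Implicit.
Unset Printing Implicit Defensive.

Import GRing.Theory.
Local Open Scope ring_scope.

(* The segments I_1, ..., I_l are the fibres of a nondecreasing map            *)
(*   blk : 'I_n -> 'I_l,                                                       *)
(* where blk i is the number of the segment that contains i; empty segments are *)
(* harmless and are allowed.                                                   *)
Definition consecutive_segments n l (blk : 'I_n -> 'I_l) : Prop :=
  {homo blk : i j / (i <= j)%N}.

Section BlockParts.
Variables (F : finFieldType) (n l : nat) (blk : 'I_n -> 'I_l).
Implicit Types M t x lam : 'M[F]_n.

Definition in_para M : bool :=
  [forall i, forall j, (blk j < blk i)%N ==> (M i j == 0)].
Definition in_uplus M : bool :=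
  [forall i, forall j, (blk j <= blk i)%N ==> (M i j == 0)].
(* The dual of u_+, under lam |-> (x |-> \tr (lam *m x)); see dual_mull and    *)
(* dual_mulr below.                                                            *)
Definition in_uminus M : bool :=
  [forall i, forall j, (blk i <= blk j)%N ==> (M i j == 0)].

Definition para_part M : 'M[F]_n :=
  \matrix_(i, j) if (blk i <= blk j)%N then M i j else 0.
Definition low_part M : 'M[F]_n :=
  \matrix_(i, j) if (blk j < blk i)%N then M i j else 0.

Lemma para_low M : para_part M + low_part M = M.
Proof.
by apply/matrixP=> i j; rewrite !mxE; case: leqP; rewrite ?addr0 ?add0r.
Qed.

Lemma in_paraP M :
  reflect (forall i j, (blk j < blk i)%N -> M i j = 0) (in_para M).
Proof.
apply: (iffP forallP) => [H i j ij | H i].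
  by move/forallP/(_ j): (H i); rewrite ij => /eqP.
by apply/forallP=> j; apply/implyP=> ij; rewrite H.
Qed.

Lemma in_uplusP M :
  reflect (forall i j, (blk j <= blk i)%N -> M i j = 0) (in_uplus M).
Proof.
apply: (iffP forallP) => [H i j ij | H i].
  by move/forallP/(_ j): (H i); rewrite ij => /eqP.
by apply/forallP=> j; apply/implyP=> ij; rewrite H.
Qed.

Lemma in_uminusP M :
  reflect (forall i j, (blk i <= blk j)%N -> M i j = 0) (in_uminus M).
Proof.
apply: (iffP forallP) => [H i j ij | H i].
  by move/forallP/(_ j): (H i); rewrite ij => /eqP.
by apply/forallP=> j; apply/implyP=> ij; rewrite H.
Qed.

Lemma para_partP M : in_para (para_part M).
Proof. by apply/in_paraP=> i j ij; rewrite mxE leqNgt ij. Qed.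

Lemma low_partP M : in_uminus (low_part M).
Proof. by apply/in_uminusP=> i j ij; rewrite mxE ltnNge ij. Qed.

Lemma para_part_id M : in_para M -> para_part M = M.
Proof.
by move/in_paraP=> H; apply/matrixP=> i j; rewrite mxE; case: leqP => // /H.
Qed.

Lemma low_part_id M : in_uminus M -> low_part M = M.
Proof.
by move/in_uminusP=> H; apply/matrixP=> i j; rewrite mxE; case: ltnP => // /H.
Qed.

Lemma low_part0 M : in_para M -> low_part M = 0.
Proof.
by move/in_paraP=> H; apply/matrixP=> i j; rewrite !mxE; case: ltnP => // /H.
Qed.

Lemma para_part0 M : in_uminus M -> para_part M = 0.
Proof.
by move/in_uminusP=> H; apply/matrixP=> i j; rewrite !mxE; case: leqP => // /H.
Qed.

Lemma para_partD : {morph para_part : M N / M + N}.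
Proof. by move=> M N; apply/matrixP=> i j; rewrite !mxE; case: ifP; rewrite ?addr0. Qed.

Lemma low_partD : {morph low_part : M N / M + N}.
Proof. by move=> M N; apply/matrixP=> i j; rewrite !mxE; case: ifP; rewrite ?addr0. Qed.

Lemma para_partZ (a : F) M : a *: para_part M = para_part (a *: M).
Proof. by apply/matrixP=> i j; rewrite !mxE; case: ifP; rewrite ?mulr0. Qed.

Lemma low_partZ (a : F) M : a *: low_part M = low_part (a *: M).
Proof. by apply/matrixP=> i j; rewrite !mxE; case: ifP; rewrite ?mulr0. Qed.

Lemma in_para_mul s t : in_para s -> in_para t -> in_para (s *m t).
Proof.
move=> /in_paraP Hs /in_paraP Ht; apply/in_paraP=> i j ij; rewrite mxE big1 // => k _.
case: (ltnP (blk k) (blk i)) => [/Hs-> | ik]; first by rewrite mul0r.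
by rewrite (Ht k) ?mulr0 //; apply: leq_trans ij ik.
Qed.

Lemma in_para1 : in_para 1%:M.
Proof.
by apply/in_paraP=> i j ij; rewrite mxE; case: eqP ij => // ->; rewrite ltnn.
Qed.

Lemma low_part_mull t M : in_para t -> low_part (t *m low_part M) = low_part (t *m M).
Proof.
move=> Ht; rewrite -{2}[M]para_low mulmxDr low_partD.
by rewrite [X in _ = X + _]low_part0 ?add0r //; apply: in_para_mul (para_partP _).
Qed.

Lemma low_part_mulr t M : in_para t -> low_part (low_part M *m t) = low_part (M *m t).
Proof.
move=> Ht; rewrite -{2}[M]para_low mulmxDl low_partD.
by rewrite [X in _ = X + _]low_part0 ?add0r //; apply: in_para_mul (para_partP _) _.
Qed.

Lemma mxtrace_low_part M x : in_uplus x -> \tr (low_part M *m x) = \tr (M *m x).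
Proof.
move/in_uplusP=> Hx; rewrite /mxtrace; apply: eq_bigr => i _.
rewrite !mxE; apply: eq_bigr => j _; rewrite mxE; case: ltnP => // ij.
by rewrite Hx ?mulr0.
Qed.

(* (t lam)(x) = lam(x t) and (lam t)(x) = lam(t x). *)
Lemma dual_mull t lam x : in_uplus x ->
  \tr (low_part (t *m lam) *m x) = \tr (lam *m (x *m t)).
Proof. by move=> Hx; rewrite mxtrace_low_part // mulmxA [RHS]mxtrace_mulC mulmxA. Qed.

Lemma dual_mulr t lam x : in_uplus x ->
  \tr (low_part (lam *m t) *m x) = \tr (lam *m (t *m x)).
Proof. by move=> Hx; rewrite mxtrace_low_part // mulmxA. Qed.

End BlockParts.

(* gl^a(n) = p (+) u_-^a.  An element t + lam is represented by the matrix     *)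
(* whose block upper triangular part is t and whose strictly block lower       *)
(* triangular part is lam; only the multiplication differs from that of 'M_n.  *)
Definition gla (F : finFieldType) n l (blk : 'I_n -> 'I_l) : Type := 'M[F]_n.

Section Contraction.
Variables (F : finFieldType) (n l : nat) (blk : 'I_n -> 'I_l).
Local Notation gla := (gla F blk).
Local Notation pp := (para_part blk).
Local Notation lp := (low_part blk).

HB.instance Definition _ := Finite.copy gla 'M[F]_n.
HB.instance Definition _ := GRing.Lmodule.copy gla 'M[F]_n.

Definition gla_mul (A B : gla) : gla :=
  pp A *m pp B + lp (pp A *m lp B + lp A *m pp B).

Lemma para_part_glaM A B : pp (gla_mul A B) = pp A *m pp B.
Proof.
rewrite para_partD [X in _ + X]para_part0 ?low_partP // addr0.
by apply: para_part_id; apply: in_para_mul; apply: para_partP.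
Qed.

Lemma low_part_glaM A B : lp (gla_mul A B) = lp (pp A *m lp B + lp A *m pp B).
Proof.
rewrite low_partD [X in X + _]low_part0; last first.
  by apply: in_para_mul; apply: para_partP.
by rewrite add0r [LHS]low_part_id ?low_partP.
Qed.

Fact gla_mulA : associative gla_mul.
Proof.
move=> A B C; rewrite {1}/gla_mul [in RHS]/gla_mul !para_part_glaM !low_part_glaM mulmxA.
congr (_ + _); rewrite low_partD low_part_mull ?para_partP // -low_partD.
rewrite [RHS]low_partD low_part_mulr ?para_partP // -low_partD.
by rewrite mulmxDr mulmxDl !mulmxA addrA.
Qed.

Fact para_part1 : pp (1%:M : 'M[F]_n) = 1%:M. Proof. by rewrite para_part_id ?in_para1. Qed.
Fact low_part1 : lp (1%:M : 'M[F]_n) = 0. Proof. by rewrite low_part0 ?in_para1. Qed.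

Fact gla_mul1 : left_id (1%:M : gla) gla_mul.
Proof.
move=> A; rewrite /gla_mul para_part1 low_part1 !mul1mx mul0mx addr0.
by rewrite low_part_id ?low_partP // para_low.
Qed.

Fact gla_1mul : right_id (1%:M : gla) gla_mul.
Proof.
move=> A; rewrite /gla_mul para_part1 low_part1 !mulmx1 mulmx0 add0r.
by rewrite low_part_id ?low_partP // para_low.
Qed.

Fact gla_mulDl : left_distributive gla_mul +%R.
Proof.
move=> A B C; rewrite /gla_mul para_partD (low_partD blk A B) !mulmxDl.
by rewrite [RHS]addrACA -low_partD; congr (_ + low_part _ _); rewrite addrACA.
Qed.

Fact gla_mulDr : right_distributive gla_mul +%R.
Proof.
move=> A B C; rewrite /gla_mul para_partD (low_partD blk B C) !mulmxDr.
by rewrite [RHS]addrACA -low_partD; congr (_ + low_part _ _); rewrite addrACA.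
Qed.

HB.instance Definition _ := GRing.Zmodule_isPzRing.Build gla
  gla_mulA gla_mul1 gla_1mul gla_mulDl gla_mulDr.

Fact gla_scaleAl (a : F) (A B : gla) : a *: (A * B) = (a *: A) * B.
Proof.
by rewrite /GRing.mul /= /gla_mul scalerDr low_partZ scalerDr !scalemxAl para_partZ low_partZ.
Qed.

Fact gla_scaleAr (a : F) (A B : gla) : a *: (A * B) = A * (a *: B).
Proof.
by rewrite /GRing.mul /= /gla_mul scalerDr low_partZ scalerDr !scalemxAr para_partZ low_partZ.
Qed.

Definition GLa : {set gla} :=
  [set A : gla | [exists B : gla, (A * B == 1) && (B * A == 1)]].

Definition uplus : {set gla} := [set X : gla | in_uplus blk X].
Definition uminus : {set gla} := [set X : gla | in_uminus blk X].
Definition ua : {set gla} := [set X + Y | X in uplus, Y in uminus].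
Definition Ua : {set gla} := [set 1 + X | X in ua].

Definition Kclass (u : gla) : {set gla} :=
  [set 1 + A * (u - 1) * B | A in GLa, B in GLa].

End Contraction.

Section Roots.
Variables (n l : nat) (blk : 'I_n -> 'I_l).
Local Notation root := ('I_n * 'I_n)%type.
Implicit Types D : {set root}.

Definition Delta : {set root} := [set g : root | blk g.1 != blk g.2].
Definition pos_roots : {set root} := [set g : root | (blk g.1 < blk g.2)%N].
Definition neg_roots : {set root} := [set g : root | (blk g.2 < blk g.1)%N].

Definition rook_placement D : Prop :=
  [/\ D \subset Delta,
      forall i, (#|[set g in D | g.1 == i]| <= 1)%N
    & forall j, (#|[set g in D | g.2 == j]| <= 1)%N].

Definition WL : {set 'S_n} := [set w : 'S_n | [forall i, blk (w i) == blk i]].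

Definition act_root (w1 w2 : 'S_n) (g : root) : root :=
  (w1 g.1, (w2^-1)%g g.2).

Definition WL_conjugate D D' : Prop :=
  exists w1 w2, [/\ w1 \in WL, w2 \in WL & D' = act_root w1 w2 @: D].

End Roots.

Section RookElements.
Variables (F : finFieldType) (n l : nat) (blk : 'I_n -> 'I_l).

(* Both E_g (g positive) and F_g (g negative) are the matrix unit at g. *)
Definition XD (D : {set 'I_n * 'I_n}) : gla F blk :=
  \sum_(g in D :&: pos_roots blk) delta_mx g.1 g.2
    + \sum_(g in D :&: neg_roots blk) delta_mx g.1 g.2.
Definition uD (D : {set 'I_n * 'I_n}) : gla F blk := 1 + XD D.

End RookElements.

(* Main.v *)
Require Import Defs.
From mathcomp Require Import all_boot all_order all_fingroup all_algebra.
From mathcomp Require Import zify.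

(* Let w(k, m) be the distance travelled from segment k forwards to segment m  *)
(* on the cycle of l segments.  In gl^a(n) the product of the matrix units at  *)
(* (p, r) and (r, q) is the matrix unit at (p, q) when w is additive along     *)
(* p, r, q, and 0 otherwise; this makes positive and negative roots alike.     *)
(* Existence: an entry of X at minimal w among those not yet treated can be    *)
(* used as a pivot to clear its entire row and column, because additivity of w *)
(* then holds wherever the elimination needs it.                               *)
(* Uniqueness: cutting a matrix down to a cyclic interval of segments that     *)
(* starts at a gives a multiplicative map from gl^a(n) to ordinary matrices,   *)
(* so the rank of the image is constant on classes.  On X_D this rank counts   *)
(* the rooks in the window, and differences of these counts give the number of *)
(* rooks of D in each block, which determines D up to W_L x W_L.               *)

(** By [glaE], a path p, r, q contributes to the product of [gla] exactly when the segment of r lies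
    on the forward arc from that of p to that of q. [pivot] is Gaussian elimination under this rule,
    and [reduce_to_rook] iterates it on shortest arcs. For uniqueness, opening the cycle at a
    segment makes the arcs that avoid the cut behave as ordinary triangular matrices ([windowM]), so
    [rank_window_equiv] yields rank invariants. From these [card_block_rooks_equiv] recovers the
    block counts, and [card_block_rooks_conj] shows that they determine the orbit. Conversely,
    permutation matrices of W_L are units and realise the conjugations ([WL_conjugate_equiv]). *)

Definition cycdist (l a b : nat) : nat :=
  if a <= b then b - a else b + l - a.

Ltac cycdist_lia :=
  rewrite /cycdist /=;
  repeat match goal with
  | |- context [if (?m <= ?n)%N then _ else _] => case: (leqP m n) => ?
  end; lia.

(** * Arithmetic of arcs on the cycle of segments *)

Section CyclicDistance.
Variable l : nat.
Local Notation cycdist := (cycdist l).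

Lemma cycdistxx a : cycdist a a = 0.
Proof. by rewrite /cycdist leqnn subnn. Qed.

Lemma cycdist_eq0 a b : a < l -> cycdist a b = 0 -> a = b.
Proof. cycdist_lia. Qed.

(** Looking back from c, b is met no later than a, so b lies on the arc from a to c. *)
Lemma cycdist_split a b c : a < l -> b < l -> c < l ->
  cycdist b c <= cycdist a c -> cycdist a b + cycdist b c = cycdist a c.
Proof. cycdist_lia. Qed.

Lemma cycdist_splitr a b c : a < l -> b < l -> c < l ->
  cycdist a b <= cycdist a c -> cycdist a b + cycdist b c = cycdist a c.
Proof. cycdist_lia. Qed.

Lemma cycdist_triangle a b c : a < l -> b < l -> c < l ->
  cycdist a c <= cycdist a b + cycdist b c.
Proof. cycdist_lia. Qed.

Lemma cycdist_pred (a c : 'I_l) : a != c ->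
  exists b : 'I_l, cycdist a c = (cycdist b c).+1.
Proof.
move=> ac; have ac' : (a : nat) <> c by move=> e; case/eqP: ac; apply: val_inj.
have [ha hc] := (ltn_ord a, ltn_ord c).
case: (ltnP a.+1 l) => al.
  by exists (Ordinal al); cycdist_lia.
have l0 : 0 < l by lia.
by exists (Ordinal l0); cycdist_lia.
Qed.

Lemma cycdist_inj (a b c : 'I_l) : (cycdist a b == cycdist a c) = (b == c).
Proof.
have [ha [hb hc]] := (ltn_ord a, (ltn_ord b, ltn_ord c)).
by rewrite -(inj_eq val_inj); apply/eqP/eqP; cycdist_lia.
Qed.

Lemma cycdist_injl (a b c : 'I_l) : (cycdist b a == cycdist c a) = (b == c).
Proof.
have [ha [hb hc]] := (ltn_ord a, (ltn_ord b, ltn_ord c)).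
by rewrite -(inj_eq val_inj); apply/eqP/eqP; cycdist_lia.
Qed.

End CyclicDistance.

(** * The product in cyclic form, and two-sided equivalence *)

Section Contraction.
Set Implicit Arguments.
Unset Strict Implicit.
Import GRing.Theory.
Local Open Scope ring_scope.

Variables (F : finFieldType) (n l : nat) (blk : 'I_n -> 'I_l).
Local Notation gla := (gla F blk).
Local Notation w p q := (cycdist l (blk p) (blk q)).
Implicit Types (A B X Y : gla) (D : {set 'I_n * 'I_n}).

(** For a positive or diagonal block, r must lie between p and q. For a negative one, the arc wraps
    around: r is either at or after p (upper times lower) or at or before q (lower times upper). The
    segments strictly between q and p are off the arc; they carry the lower times lower products,
    which vanish. *)
Lemma glaE A B p q : (A * B) p q =
  \sum_(r | (w p r + w r q == w p q)%N) A p r * B r q.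
Proof.
rewrite [A * B]/(gla_mul A B) !mxE [RHS]big_mkcond /=.
have [hp hq] := (ltn_ord (blk p), ltn_ord (blk q)).
have [pq|qp] := leqP (blk p) (blk q).
  rewrite addr0; apply: eq_bigr => r _; rewrite !mxE.
  have hr := ltn_ord (blk r).
  case: eqP; (case: ifP => pr; case: ifP => rq); rewrite ?mul0r ?mulr0 //;
  by move: pr rq; cycdist_lia.
rewrite big1 ?add0r => [|r _]; last first.
  rewrite !mxE; case: leqP => pr; last by rewrite mul0r.
  by case: leqP => rq; rewrite ?mulr0 //; lia.
rewrite -big_split /=; apply: eq_bigr => r _; rewrite !mxE.
have hr := ltn_ord (blk r).
case: eqP; (case: (leqP (blk p) (blk r)) => pr; case: (leqP (blk r) (blk q)) => rq);
  rewrite ?mul0r ?mulr0 ?addr0 ?add0r //; by cycdist_lia.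
Qed.

Lemma glaBE X Y p q : (X - Y) p q = X p q - Y p q.
Proof. by rewrite !mxE. Qed.

Definition GLa_equiv X Y : Prop :=
  exists A B, [/\ A \in GLa F blk, B \in GLa F blk & Y = A * X * B].

Lemma GLaP A :
  reflect (exists B : gla, A * B = 1 /\ B * A = 1) (A \in GLa F blk).
Proof.
rewrite inE; apply: (iffP existsP) => [[B /andP[/eqP ? /eqP ?]] | [B [AB BA]]].
  by exists B.
by exists B; rewrite AB BA eqxx.
Qed.

Lemma GLa1 : (1 : gla) \in GLa F blk.
Proof. by apply/GLaP; exists 1; rewrite mulr1. Qed.

Lemma GLaM A B : A \in GLa F blk -> B \in GLa F blk -> A * B \in GLa F blk.
Proof.
move=> /GLaP[A' [AA' A'A]] /GLaP[B' [BB' B'B]]; apply/GLaP; exists (B' * A').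
by rewrite mulrA -(mulrA A) BB' mulr1 AA' mulrA -(mulrA B') A'A mulr1 B'B.
Qed.

Lemma GLa_equiv_refl X : GLa_equiv X X.
Proof. by exists 1, 1; rewrite mul1r mulr1 GLa1. Qed.

Lemma GLa_equiv_sym X Y : GLa_equiv X Y -> GLa_equiv Y X.
Proof.
move=> [A [B [/GLaP[A' [AA' A'A]] /GLaP[B' [BB' B'B]] ->]]].
exists A', B'; split; [by apply/GLaP; exists A | by apply/GLaP; exists B |].
by rewrite !mulrA A'A mul1r -mulrA BB' mulr1.
Qed.

Lemma GLa_equiv_trans X Y Z : GLa_equiv X Y -> GLa_equiv Y Z -> GLa_equiv X Z.
Proof.
move=> [A [B [A_GL B_GL ->]]] [C [E [C_GL E_GL ->]]].
by exists (C * A), (B * E); rewrite !GLaM ?mulrA.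
Qed.

Lemma mem_Kclass (u v : gla) : v \in Kclass u <-> GLa_equiv (u - 1) (v - 1).
Proof.
split=> [/imset2P[A B A_GL B_GL ->] | [A [B [A_GL B_GL e]]]].
  by exists A, B; rewrite addrC addKr.
by apply/imset2P; exists A B; rewrite // -e addrC subrK.
Qed.

(* The inverse is 1 + c N. *)
Lemma sub1_GLa (N : gla) (c : F) : c != 0 -> N * N = (1 - c^-1) *: N ->
  1 - N \in GLa F blk.
Proof.
move=> c0 NN; have e : c *: (N * N) = c *: N - N.
  by rewrite NN scalerA mulrBr mulr1 divff // scalerBl scale1r.
apply/GLaP; exists (1 + c *: N); split.
  rewrite mulrBl mul1r mulrDr mulr1 -gla_scaleAr e.
  by rewrite (addrC N) subrK addrK.
rewrite mulrDl mul1r mulrBr mulr1 -gla_scaleAl e.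
by rewrite subKr subrK.
Qed.

(** * Elimination by units of the contraction *)

Lemma row_op (f : 'I_n -> F) i X : f i != 1 ->
  exists2 A, A \in GLa F blk & forall p q, (A * X) p q =
    X p q - if (w p i + w i q == w p q)%N then f p * X i q else 0.
Proof.
(* Supported on column i, N satisfies N * N = f i N, so 1 - N is a unit when f i is not 1. *)
move=> fi; pose N : gla := \matrix_(p, q) if q == i then f p else 0.
have NE Y p q : (N * Y) p q =
    if (w p i + w i q == w p q)%N then f p * Y i q else 0.
  rewrite glaE big_mkcond (bigD1 i) //= big1 => [|r /negPf ri].
    by rewrite addr0 mxE eqxx.
  by rewrite mxE ri mul0r if_same.
exists (1 - N) => [|p q]; last by rewrite mulrBl mul1r -NE glaBE.
have f1 : 1 - f i != 0 by rewrite subr_eq0 eq_sym.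
apply: (@sub1_GLa N (1 - f i)^-1); first by rewrite invr_eq0.
rewrite invrK opprB addrC subrK; apply/matrixP => p q.
rewrite NE !mxE; case: (q =P i) => [->|_]; last by rewrite !mulr0 if_same.
by rewrite cycdistxx addn0 eqxx mulrC.
Qed.

Lemma col_op (f : 'I_n -> F) j X : f j != 1 ->
  exists2 B, B \in GLa F blk & forall p q, (X * B) p q =
    X p q - if (w p j + w j q == w p q)%N then X p j * f q else 0.
Proof.
move=> fj; pose N : gla := \matrix_(p, q) if p == j then f q else 0.
have NE Y p q : (Y * N) p q =
    if (w p j + w j q == w p q)%N then Y p j * f q else 0.
  rewrite glaE big_mkcond (bigD1 j) //= big1 => [|r /negPf ri].
    by rewrite addr0 mxE eqxx.
  by rewrite mxE ri mulr0 if_same.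
exists (1 - N) => [|p q]; last by rewrite mulrBr mulr1 -NE glaBE.
have f1 : 1 - f j != 0 by rewrite subr_eq0 eq_sym.
apply: (@sub1_GLa N (1 - f j)^-1); first by rewrite invr_eq0.
rewrite invrK opprB addrC subrK; apply/matrixP => p q.
rewrite NE !mxE; case: (p =P j) => [->|_]; last by rewrite mul0r mulr0 if_same.
by rewrite cycdistxx add0n eqxx.
Qed.

(** Minimality puts i on the arc from p to j whenever X p j is nonzero, so the row operation clears
    column j; dually, j is on the arc from i to q. Since column j is already a unit column when row
    i is cleared, the other rows change only once. *)
Lemma pivot X i j : X i j != 0 ->
    (forall p, X p j != 0 -> (w i j <= w p j)%N) ->
    (forall q, X i q != 0 -> (w i j <= w i q)%N) ->
  exists A B, [/\ A \in GLa F blk, B \in GLa F blk,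
    forall q, (A * X * B) i q = (q == j)%:R &
    forall p q, p != i -> (A * X * B) p q = X p q -
      if (w p i + w i q == w p q)%N then X p j / X i j * X i q else 0].
Proof.
move=> Xij minj mini; set c := X i j.
(* At i the coefficient is 1 - 1/c, which differs from 1 and scales the pivot to 1. *)
have [|A A_GL AX] := @row_op (fun p => (X p j - (p == i)%:R) / c) i X.
  rewrite eqxx mulrBl divff // -subr_eq0 addrC addKr oppr_eq0.
  by rewrite mul1r invr_eq0.
have Yj p : (A * X) p j = (p == i)%:R.
  rewrite AX -/c; case: eqP => [_|].
    by rewrite divfK // subKr.
  have [->|] := eqVneq p i; first by rewrite cycdistxx.
  move=> _ e; rewrite subr0; apply/eqP/negPn/negP => /minj le; apply: e.
  exact: cycdist_split.
have Yi q : (A * X) i q = X i q / c.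
  rewrite AX cycdistxx add0n !eqxx mulrBl divff // mulrBl !mul1r opprB.
  by rewrite addrCA subrr addr0; exact: mulrC.
have [|B B_GL AXB] := @col_op (fun q => (A * X) i q - (q == j)%:R) j (A * X).
  by rewrite Yj !eqxx subrr eq_sym oner_eq0.
exists A, B; split=> // [q|p q /negPf pi].
  rewrite AXB Yj eqxx mul1r; case: eqP => [_|]; first by rewrite subKr.
  have [->|] := eqVneq q j; first by rewrite cycdistxx addn0.
  move=> _ e; rewrite subr0 Yi; have [->|Xiq] := eqVneq (X i q) 0.
    by rewrite mul0r.
  by case: e; apply: cycdist_splitr => //; apply: mini.
by rewrite AXB Yj pi mul0r if_same subr0 AX pi subr0.
Qed.

(** * Reduction to a rook placement *)

Lemma sum_delta_mxE (S : {set 'I_n * 'I_n}) p q :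
  (\sum_(g in S) delta_mx g.1 g.2 : 'M[F]_n) p q = ((p, q) \in S)%:R.
Proof.
rewrite summxE; have [pqS|pqS] := boolP ((p, q) \in S).
  rewrite (bigD1 (p, q)) //= mxE !eqxx big1 ?addr0 // => -[r s] /andP[_].
  by rewrite mxE xpair_eqE eq_sym (eq_sym s) => /negPf->.
rewrite big1 // => -[r s] rsS; rewrite mxE; case: eqP => //= pr.
by case: eqP => // qs; rewrite pr qs rsS in pqS.
Qed.

Lemma XDE D p q : D \subset Delta blk -> XD F blk D p q = ((p, q) \in D)%:R.
Proof.
move=> DD; rewrite mxE !sum_delta_mxE !inE /=.
have [pqD|] := boolP ((p, q) \in D); last by rewrite addr0.
have := subsetP DD _ pqD; rewrite inE /= -(inj_eq val_inj) neq_ltn.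
by case: ltngtP => //= _ _; rewrite ?addr0 ?add0r.
Qed.

Lemma rook_placementP D : rook_placement blk D <->
  [/\ D \subset Delta blk, {in D &, injective fst} & {in D &, injective snd}].
Proof.
have card1 (f : 'I_n * 'I_n -> 'I_n) :
    (forall i, (#|[set g in D | f g == i]| <= 1)%N) <-> {in D &, injective f}.
  split=> [le1 g h gD hD e | finj i].
    by apply: (card_le1_eqP (le1 (f g))); rewrite !inE ?gD ?hD ?e eqxx.
  apply/card_le1_eqP => g h; rewrite !inE => /andP[gD /eqP gi] /andP[hD /eqP hi].
  by apply: finj; rewrite ?gi ?hi.
by split=> -[DD r c]; split=> //; apply/card1.
Qed.

(** D collects the pivots already used, whose rows and columns are final; the induction is on the
    number of positions outside D. *)
Lemma reduce_to_rook D X : rook_placement blk D ->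
    (forall p q, blk p = blk q -> X p q = 0) ->
    (forall g p q, g \in D -> (p == g.1) || (q == g.2) ->
      X p q = ((p, q) \in D)%:R) ->
  exists2 D', rook_placement blk D' & GLa_equiv X (XD F blk D').
Proof.
elim: {D}_.+1 {-2}D (ltnSn #|~: D|) X => // m IH D le_m X rookD X0 XD_D.
have [DD D1 D2] := (rook_placementP D).1 rookD.
pose bad (g : 'I_n * 'I_n) := X g.1 g.2 != (g \in D)%:R.
have [g0 bad0|good] := pickP bad; last first.
  exists D => //; suff -> : XD F blk D = X by apply: GLa_equiv_refl.
  by apply/matrixP=> p q; rewrite XDE //; move/negbFE/eqP: (good (p, q)).
case: (arg_minnP (fun g => w g.1 g.2) bad0) => -[i j] /=; rewrite /bad /= => badij minij.
have iD g : g \in D -> (i == g.1) = false.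
  by move=> gD; apply: contraNF badij => e; apply/eqP/(XD_D _ _ _ gD); rewrite e.
have jD g : g \in D -> (j == g.2) = false.
  by move=> gD; apply: contraNF badij => e; apply/eqP/(XD_D _ _ _ gD); rewrite e orbT.
have notDi q : ((i, q) \in D) = false.
  by apply/negP => /iD; rewrite eqxx.
have notDj p : ((p, j) \in D) = false.
  by apply/negP => /jD; rewrite eqxx.
rewrite notDi /= in badij.
(* Row i and column j contain no rook of D, so every nonzero entry there is bad and the minimality
   of (i, j) applies. *)
have minj p : X p j != 0 -> (w i j <= w p j)%N.
  by move=> Xpj; apply: (minij (p, j)); rewrite notDj.
have mini q : X i q != 0 -> (w i j <= w i q)%N.
  by move=> Xiq; apply: (minij (i, q)); rewrite notDi.
have [A [B [A_GL B_GL rowi rest]]] := pivot badij minj mini.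
have ijD : blk i != blk j by apply: contraNneq badij => /X0->.
case: (IH ((i, j) |: D) _ (A * X * B)).
- rewrite -ltnS; apply: leq_trans le_m; rewrite ltnS.
  apply: proper_card; rewrite properEneq setCS subsetUr andbT.
  by apply/eqP => /setC_inj/setP/(_ (i, j)); rewrite notDi !inE eqxx.
- apply/rook_placementP; split.
  + by rewrite subUset sub1set inE ijD.
  + move=> g h /setU1P[->|gD] /setU1P[->|hD] //= /eqP; first by rewrite iD.
      by rewrite eq_sym iD.
    by move/eqP; apply: D1.
  + move=> g h /setU1P[->|gD] /setU1P[->|hD] //= /eqP; first by rewrite jD.
      by rewrite eq_sym jD.
    by move/eqP; apply: D2.
- move=> p q pq; have [pi|pi] := eqVneq p i.
    rewrite pi rowi; case: eqP => // qj; move: ijD.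
    by rewrite -pi -qj pq eqxx.
  (* An arc of length 0 passes only through its own segment, so a correction here involves a
     diagonal entry [X i q], which is zero. *)
  rewrite rest // X0 // sub0r pq cycdistxx addn_eq0.
  case: ifP => [/andP[_ /eqP /cycdist_eq0 e]|]; last by rewrite oppr0.
  by rewrite (X0 i q) ?mulr0 ?oppr0 //; apply/val_inj/e.
- move=> g p q; rewrite !inE xpair_eqE; have [->|pi] := eqVneq p i.
    by rewrite rowi notDi orbF.
  rewrite rest //= => /orP[/eqP->/=|gD].
    rewrite (negPf pi) /= => /eqP->; rewrite notDj divfK //.
    case: eqP => [_|e]; first by rewrite subrr.
    rewrite subr0; apply/eqP/negPn/negP => /minj le; apply: e.
    exact: cycdist_split.
  move=> pq; rewrite (XD_D g) //.
  (* A finished row meets column j in 0, and a finished column meets row i in 0. *)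
  suff -> : X p j / X i j * X i q = 0 by rewrite if_same subr0.
  case/orP: pq => /eqP->.
    by rewrite (XD_D g g.1) ?eqxx // notDj !mul0r.
  by rewrite (XD_D g i g.2) ?eqxx ?orbT // notDi mulr0.
move=> D' rookD' eqv; exists D'; first exact: rookD'.
by apply: GLa_equiv_trans eqv; exists A, B.
Qed.

Lemma mem_ua X : X \in ua F blk <-> forall p q, blk p = blk q -> X p q = 0.
Proof.
split=> [/imset2P[Y Z] | X0].
  rewrite !inE => /in_uplusP Y0 /in_uminusP Z0 -> p q pq.
  by rewrite mxE Y0 ?Z0 ?addr0 ?pq.
apply/imset2P; exists (para_part blk X) (low_part blk X); last by rewrite para_low.
  rewrite inE; apply/in_uplusP => p q qp; rewrite mxE; case: ifP => // pq.
  by apply/X0/val_inj/eqP; rewrite eqn_leq pq qp.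
by rewrite inE low_partP.
Qed.

Lemma mem_Ua (u : gla) : u \in Ua F blk <-> u - 1 \in ua F blk.
Proof.
split=> [/imsetP[X Xua ->] | Xua]; first by rewrite addrC addKr.
by apply/imsetP; exists (u - 1); rewrite // addrC subrK.
Qed.

(** * Rank invariants and the number of rooks per block *)

Definition window_cond (a : 'I_l) (t : nat) (g : 'I_n * 'I_n) : bool :=
  (cycdist l a (blk g.1) + w g.1 g.2 == cycdist l a (blk g.2))%N
  && (cycdist l a (blk g.2) < t)%N.

(** The block upper triangular part for the order of segments that starts at [a], restricted to the
    first [t] of them. *)
Definition window a t X : 'M[F]_n :=
  \matrix_(p, q) if window_cond a t (p, q) then X p q else 0.

(* Inside the window w is additive along a, p, q, so by the triangle inequality *)
(* it is additive along p, r, q exactly when (p, r) and (r, q) are in it too.   *)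
Lemma windowM a t X Y : window a t (X * Y) = window a t X *m window a t Y.
Proof.
apply/matrixP=> p q; rewrite mxE glaE [RHS]mxE big_mkcond /=.
under [RHS]eq_bigr => r _ do rewrite !mxE.
have tri (b c d : 'I_l) :=
  cycdist_triangle _ _ _ _ (ltn_ord b) (ltn_ord c) (ltn_ord d).
case: ifP => [pq|pq].
  apply: eq_bigr => r _.
  move: (tri a (blk p) (blk r)) (tri (blk p) (blk r) (blk q)).
  move: (tri a (blk r) (blk q)).
  move=> t1 t2 t3; have -> : (w p r + w r q == w p q)%N =
      window_cond a t (p, r) && window_cond a t (r, q).
    by move: pq t1 t2 t3; rewrite /window_cond /=; lia.
  by case: window_cond; case: window_cond; rewrite ?mul0r ?mulr0.
rewrite big1 // => r _.
move: (tri a (blk p) (blk r)) (tri (blk p) (blk r) (blk q)).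
move: (tri a (blk r) (blk q)) (tri a (blk p) (blk q)).
move=> t1 t2 t3 t4.
have : ~~ (window_cond a t (p, r) && window_cond a t (r, q)).
  by move: pq t1 t2 t3 t4; rewrite /window_cond /=; lia.
by case: window_cond; case: window_cond; rewrite ?mul0r ?mulr0.
Qed.

(** Multiplicativity bounds the rank of the image in one direction; symmetry of the equivalence
    gives the other. *)
Lemma rank_window_equiv a t X Y :
  GLa_equiv X Y -> \rank (window a t X) = \rank (window a t Y).
Proof.
have le Z W : GLa_equiv Z W -> (\rank (window a t W) <= \rank (window a t Z))%N.
  move=> [A [B [_ _ ->]]]; rewrite !windowM.
  exact: leq_trans (mxrankM_maxl _ _) (mxrankM_maxr _ _).
by move=> XY; apply/eqP; rewrite eqn_leq (le _ _ XY) (le _ _ (GLa_equiv_sym XY)).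
Qed.

Definition window_rooks D a t := [set g in D | window_cond a t g].

Definition block_rooks D (k m : 'I_l) :=
  [set g in D | (blk g.1 == k) && (blk g.2 == m)].

Definition column_rooks D (k m : 'I_l) :=
  [set g in D | (blk g.2 == m) && (cycdist l (blk g.1) m <= cycdist l k m)%N].

(** The matrix factors through dimension #|S| as U V, where U has a left inverse and V a right
    inverse, namely their transposes. *)
Lemma rank_partial_perm (S : {set 'I_n * 'I_n}) :
    {in S &, injective fst} -> {in S &, injective snd} ->
  \rank (\matrix_(p, q) ((p, q) \in S)%:R : 'M[F]_n) = #|S|.
Proof.
move=> S1 S2; set M := \matrix_(p, q) _.
pose U : 'M[F]_(n, #|S|) := \matrix_(p, k) (p == (enum_val k).1)%:R.
pose V : 'M[F]_(#|S|, n) := \matrix_(k, q) (q == (enum_val k).2)%:R.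
have MUV : M = U *m V.
  apply/matrixP => p q; rewrite !mxE -sum_delta_mxE summxE big_enum_val /=.
  by apply: eq_bigr => k _; rewrite !mxE -natrM mulnb.
have UU : U^T *m U = 1%:M.
  apply/matrixP => k k'; rewrite !mxE (bigD1 (enum_val k).1) //= !mxE eqxx mul1r.
  rewrite big1 ?addr0 => [|p /negPf pk]; last by rewrite !mxE pk mul0r.
  by rewrite (inj_in_eq S1) ?enum_valP // (inj_eq enum_val_inj).
have VV : V *m V^T = 1%:M.
  apply/matrixP => k k'; rewrite !mxE (bigD1 (enum_val k).2) //= !mxE eqxx mul1r.
  rewrite big1 ?addr0 => [|p /negPf pk]; last by rewrite !mxE pk mul0r.
  by rewrite (inj_in_eq S2) ?enum_valP // (inj_eq enum_val_inj).
apply/eqP; rewrite eqn_leq {1}MUV; apply/andP; split.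
  exact: leq_trans (mxrankM_maxl _ _) (rank_leq_col _).
rewrite -{1}(mxrank1 F #|S|).
have -> : 1%:M = U^T *m M *m V^T by rewrite MUV mulmxA UU mul1mx VV.
exact: leq_trans (mxrankM_maxl _ _) (mxrankM_maxr _ _).
Qed.

Lemma rank_window_XD D a t : rook_placement blk D ->
  \rank (window a t (XD F blk D)) = #|window_rooks D a t|.
Proof.
move/rook_placementP => [DD D1 D2]; rewrite -rank_partial_perm.
- congr (\rank _); apply/matrixP => p q; rewrite [LHS]mxE XDE // mxE inE.
  by case: window_cond; rewrite ?andbT ?andbF.
- by move=> g h; rewrite !inE => /andP[gD _] /andP[hD _]; apply: D1.
- by move=> g h; rewrite !inE => /andP[gD _] /andP[hD _]; apply: D2.
Qed.

(** The shorter window stops just before segment m; the longer one adds the rooks with column in m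
    and row on the arc from k to m. *)
Lemma card_window_rooksS D (k m : 'I_l) :
  #|window_rooks D k (cycdist l k m).+1| =
    (#|window_rooks D k (cycdist l k m)| + #|column_rooks D k m|)%N.
Proof.
rewrite -(cardsID [set g | blk g.2 == m] (window_rooks D k _.+1)) addnC.
congr (_ + _)%N; apply: eq_card => -[p q]; rewrite !inE /window_cond /=.
  rewrite -(cycdist_inj _ k).
  by rewrite andbCA; congr (_ && _); lia.
rewrite -andbA; congr (_ && _); case: (blk q =P m) => [->|]; last by rewrite andbF.
rewrite ltnSn !andbT; apply/eqP/idP => [<-|]; first exact: leq_addl.
exact: cycdist_split.
Qed.

(** Here k' is the segment next after k, so passing to k' drops only k from the arc to m. *)
Lemma card_block_rooks D (k k' m : 'I_l) :
    cycdist l k m = (cycdist l k' m).+1 ->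
  #|column_rooks D k m| =
  (#|block_rooks D k m| + #|column_rooks D k' m|)%N.
Proof.
move=> kk'; rewrite -(cardsID [set g | blk g.1 == k] (column_rooks D k m)).
congr (_ + _)%N; apply: eq_card => -[p q]; rewrite !inE /=.
  rewrite -andbA; congr (_ && _); rewrite andbC.
  by case: eqP => //= ->; rewrite leqnn andbT.
by rewrite andbCA -(cycdist_injl _ m) kk'; congr (_ && _); lia.
Qed.

Lemma card_block_rooks_equiv D D' (k m : 'I_l) :
    rook_placement blk D -> rook_placement blk D' ->
    GLa_equiv (XD F blk D) (XD F blk D') ->
  #|block_rooks D k m| = #|block_rooks D' k m|.
Proof.
move=> rookD rookD' eqv.
have eqW a t : #|window_rooks D a t| = #|window_rooks D' a t|.
  by rewrite -!rank_window_XD //; apply: rank_window_equiv.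
have eqU k1 m1 : #|column_rooks D k1 m1| = #|column_rooks D' k1 m1|.
  apply/eqP; rewrite -(eqn_add2l #|window_rooks D k1 (cycdist l k1 m1)|).
  by rewrite -card_window_rooksS eqW card_window_rooksS eqW.
(* Diagonal blocks contain no roots; elsewhere the arc from k to m can be shortened by one step. *)
have [->|/cycdist_pred[k' kk']] := eqVneq k m.
  have block0 E : rook_placement blk E -> block_rooks E m m = set0.
    move/rook_placementP => [/subsetP EE _ _]; apply/setP => g; rewrite !inE.
    apply/negP => /and3P[/EE]; rewrite inE => /eqP gg /eqP g1 /eqP g2.
    by case: gg; rewrite g1 g2.
  by rewrite !block0.
apply/eqP; rewrite -(eqn_add2r #|column_rooks D k' m|).
by rewrite -card_block_rooks // eqU (card_block_rooks D' kk') (eqU k').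
Qed.

End Contraction.

(** * Block counts determine the orbit under W_L x W_L *)

Section Conjugacy.
Set Implicit Arguments.
Unset Strict Implicit.

Variables (n l : nat) (blk : 'I_n -> 'I_l).
Implicit Types (D : {set 'I_n * 'I_n}) (s : 'S_n).

Lemma WLP s : reflect (forall i, blk (s i) = blk i) (s \in WL blk).
Proof. by rewrite inE; apply: (iffP forallP) => e i; apply/eqP/e. Qed.

Lemma WLV s : s \in WL blk -> (s^-1)%g \in WL blk.
Proof. by move/WLP=> e; apply/WLP=> i; rewrite -{2}(permKV s i) e. Qed.

Lemma WLM s1 s2 : s1 \in WL blk -> s2 \in WL blk -> (s1 * s2)%g \in WL blk.
Proof. by move=> /WLP e1 /WLP e2; apply/WLP=> i; rewrite permM e2 e1. Qed.

Lemma WL_tperm i j : blk i = blk j -> tperm i j \in WL blk.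
Proof. by move=> ij; apply/WLP=> k; case: tpermP => [->|->|]. Qed.

Lemma act_root_inj s1 s2 : injective (act_root s1 s2).
Proof. by move=> [p q] [p' q'] [/perm_inj-> /perm_inj->]. Qed.

Lemma mem_act_root s1 s2 D p q :
  ((p, q) \in act_root s1 s2 @: D) = (((s1^-1)%g p, s2 q) \in D).
Proof.
have {1}-> : (p, q) = act_root s1 s2 ((s1^-1)%g p, s2 q).
  by rewrite /act_root /= permKV permK.
by rewrite mem_imset //; apply: act_root_inj.
Qed.

Lemma rook_placement_act s1 s2 D : s1 \in WL blk -> s2 \in WL blk ->
  rook_placement blk D -> rook_placement blk (act_root s1 s2 @: D).
Proof.
move=> s1W /WLV/WLP s2W; move/WLP in s1W.
move=> /rook_placementP[/subsetP DD D1 D2]; apply/rook_placementP; split.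
- by apply/subsetP => _ /imsetP[g /DD gD ->]; move: gD; rewrite !inE /= s1W s2W.
- move=> _ _ /imsetP[g gD ->] /imsetP[h hD ->] /= /perm_inj e.
  by rewrite (D1 g h).
- move=> _ _ /imsetP[g gD ->] /imsetP[h hD ->] /= /perm_inj e.
  by rewrite (D2 g h).
Qed.

Lemma card_block_rooks_act s1 s2 D k m : s1 \in WL blk -> s2 \in WL blk ->
  #|block_rooks blk (act_root s1 s2 @: D) k m| = #|block_rooks blk D k m|.
Proof.
move=> s1W s2W.
rewrite -(card_imset (block_rooks _ D _ _) (@act_root_inj s1 s2)).
apply: eq_card => -[p q]; rewrite mem_act_root !inE mem_act_root /=.
by rewrite (WLP _ (WLV s1W)) (WLP _ s2W).
Qed.

Lemma WL_conjugate_refl D : WL_conjugate blk D D.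
Proof.
exists 1%g, 1%g; split; try by apply/WLP => i; rewrite perm1.
by apply/setP => -[p q]; rewrite mem_act_root invg1 !perm1.
Qed.

Lemma WL_conjugate_act s1 s2 D D' : s1 \in WL blk -> s2 \in WL blk ->
  WL_conjugate blk (act_root s1 s2 @: D) D' -> WL_conjugate blk D D'.
Proof.
move=> s1W s2W [t1 [t2 [t1W t2W ->]]].
(* The second factors compose in reverse because [act_root] inverts its second permutation. *)
exists (s1 * t1)%g, (t2 * s2)%g; rewrite !WLM //; split=> //.
by apply/setP => -[p q]; rewrite !mem_act_root invMg !permM.
Qed.

Lemma card_setD_eq (T : finType) (A B : {set T}) x :
  #|A| = #|B| -> x \in A :\: B -> exists y, y \in B :\: A.
Proof.
move=> AB xAB; apply/set0Pn; rewrite -card_gt0.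
rewrite -(ltn_add2l #|A :&: B|) addn0 {2}setIC cardsID -AB.
by rewrite -(cardsID B A) -addn1 leq_add2l card_gt0; apply/set0Pn; exists x.
Qed.

Lemma card_block_rooks_conj D D' :
    rook_placement blk D -> rook_placement blk D' ->
    (forall k m, #|block_rooks blk D k m| = #|block_rooks blk D' k m|) ->
  WL_conjugate blk D D'.
Proof.
(* Swapping a rook of D \ D' onto one of D' \ D in the same block fixes the     *)
(* common rooks, so D' \ D shrinks.                                             *)
move=> + rookD'; have [_ D'1 D'2] := (rook_placementP _ D').1 rookD'.
elim: {D}_.+1 {-2}D (ltnSn #|D' :\: D|) => // m IH D le_m rookD eqDD'.
have [DD D1 D2] := (rook_placementP blk D).1 rookD.
have swap E E' g :
    (forall k m, #|block_rooks blk E k m| = #|block_rooks blk E' k m|) ->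
    g \in E :\: E' ->
  exists2 h, h \in E' :\: E & blk g.1 = blk h.1 /\ blk g.2 = blk h.2.
  move=> eqE; rewrite inE => /andP[gE' gE].
  have [|h] := card_setD_eq (x := g) (eqE (blk g.1) (blk g.2)).
    by rewrite !inE (negPf gE') gE !eqxx.
  rewrite !inE negb_and => /andP[+ /and3P[hE' e1 e2]].
  rewrite e1 e2 orbF => hE; exists h; first by rewrite inE hE hE'.
  by rewrite (eqP e1) (eqP e2).
have [[p' q'] pq'D|D'D] := pickP (mem (D' :\: D)); last first.
  have [g gD|DD'] := pickP (mem (D :\: D')).
    by have [h] := swap _ _ _ eqDD' gD; have := D'D h; rewrite /= => ->.
  suff -> : D = D' by apply: WL_conjugate_refl.
  apply/eqP; rewrite eqEsubset -!setD_eq0.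
  by apply/andP; split; apply/eqP/setP => g; rewrite [RHS]inE; [apply: DD' | apply: D'D].
have [|[p q] pqD [/= pp' qq']] := swap D' D _ _ pq'D; first by [].
have tp := WL_tperm pp'; have tq := WL_tperm qq'.
apply: (WL_conjugate_act tp tq); apply: IH.
- rewrite -ltnS; apply: leq_trans le_m; rewrite ltnS; apply: proper_card.
  move: pq'D pqD; rewrite !inE => /andP[pq'D pq'D'] /andP[pqD' pqD].
  apply/properP; split.
    apply/subsetP => -[r s]; rewrite !inE mem_act_root tpermV => /andP[+ rsD'].
    rewrite rsD' andbT; apply: contra => rsD.
    (* One rook per row: a common rook in row p would be (p, q), and in row p' it would be (p', q'),
       neither of which is common. *)
    have [rp rp'] : r != p /\ r != p'.
      split; apply/eqP => e.
        by move: pqD'; rewrite -(D1 _ _ rsD pqD e) rsD'.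
      by move: pq'D; rewrite -(D'1 _ _ rsD' pq'D' e) rsD.
    have [sq sq'] : s != q /\ s != q'.
      split; apply/eqP => e.
        by move: pqD'; rewrite -(D2 _ _ rsD pqD e) rsD'.
      by move: pq'D; rewrite -(D'2 _ _ rsD' pq'D' e) rsD.
    by rewrite !tpermD // eq_sym.
  exists (p', q'); first by rewrite inE pq'D pq'D'.
  by rewrite inE mem_act_root tpermV !tpermL pqD.
- exact: rook_placement_act.
- by move=> k k'; rewrite card_block_rooks_act.
Qed.

End Conjugacy.

(** * Conjugate placements give equivalent elements *)

Section PermutationMatrices.
Set Implicit Arguments.
Unset Strict Implicit.
Import GRing.Theory.
Local Open Scope ring_scope.

Variables (F : finFieldType) (n l : nat) (blk : 'I_n -> 'I_l).
Local Notation gla := (gla F blk).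

Definition gla_perm (s : 'S_n) : gla := \matrix_(p, q) (q == s p)%:R.

(** As s preserves segments, p and s p are at distance 0, so the arc condition holds and no entry is
    lost. *)
Lemma gla_permMl s (X : gla) p q : s \in WL blk ->
  (gla_perm s * X) p q = X (s p) q.
Proof.
move/WLP=> sW; rewrite glaE (bigD1 (s p)) ?sW ?cycdistxx //= mxE eqxx mul1r.
by rewrite big1 ?addr0 // => r /andP[_ /negPf rp]; rewrite mxE rp mul0r.
Qed.

Lemma gla_permMr s (X : gla) p q : s \in WL blk ->
  (X * gla_perm s) p q = X p ((s^-1)%g q).
Proof.
move=> sW; rewrite glaE (bigD1 ((s^-1)%g q)) /= ?(WLP _ _ (WLV sW)) ?cycdistxx ?addn0 //.
rewrite mxE permKV eqxx mulr1 big1 ?addr0 // => r /andP[_ rq].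
by rewrite mxE -(inj_eq (@perm_inj _ (s^-1)%g)) permK eq_sym (negPf rq) mulr0.
Qed.

Lemma gla_perm_GLa s : s \in WL blk -> gla_perm s \in GLa F blk.
Proof.
move=> sW; apply/GLaP; exists (gla_perm s^-1).
by split; apply/matrixP => p q;
  rewrite gla_permMl ?WLV // !mxE ?permK ?permKV eq_sym.
Qed.

Lemma WL_conjugate_equiv D D' : rook_placement blk D -> WL_conjugate blk D D' ->
  GLa_equiv (XD F blk D) (XD F blk D').
Proof.
move=> rookD [s1 [s2 [s1W s2W ->]]].
have [rD rD'] := (rookD, rook_placement_act s1W s2W rookD).
exists (gla_perm s1^-1), (gla_perm s2^-1).
rewrite !gla_perm_GLa ?WLV //; split=> //; apply/matrixP => p q.
rewrite gla_permMr ?WLV // gla_permMl ?WLV // invgK.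
by case: rD rD' => DD _ _ [DD' _ _]; rewrite !XDE // mem_act_root.
Qed.

End PermutationMatrices.

Theorem theorem3p3 (F : finFieldType) (n l : nat) (blk : 'I_n -> 'I_l)
    (charF : 2%N \notin [pchar F]%R)
    (segments : consecutive_segments blk) :
  (forall u : gla F blk, u \in Ua F blk ->
     exists2 D : {set 'I_n * 'I_n},
       rook_placement blk D & uD F blk D \in Kclass u)
  /\
  (forall D D' : {set 'I_n * 'I_n},
     rook_placement blk D -> rook_placement blk D' ->
     ((exists2 u : gla F blk, u \in Ua F blk &
         (uD F blk D \in Kclass u) && (uD F blk D' \in Kclass u))
      <-> WL_conjugate blk D D')).
Proof.
have uD1 D : (uD F blk D - 1 = XD F blk D)%R by rewrite /uD GRing.addrC GRing.addKr.
split=> [u /mem_Ua/mem_ua u0 | D D' rookD rookD'].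
  have rook0 : rook_placement blk set0.
    by apply/rook_placementP; split=> [|g h|g h]; rewrite ?sub0set ?inE.
  have [|D rookD eqv] := reduce_to_rook rook0 u0.
    by move=> g p q; rewrite inE.
  by exists D; rewrite // mem_Kclass uD1.
split=> [[u _ /andP[/mem_Kclass uD /mem_Kclass uD']] | conj].
  rewrite !uD1 in uD uD'; apply: card_block_rooks_conj => // k m.
  apply: card_block_rooks_equiv => //.
  exact: GLa_equiv_trans (GLa_equiv_sym uD) uD'.
exists (uD F blk D).
  apply/mem_Ua/mem_ua => p q pq; case: rookD => DD _ _; rewrite uD1 XDE //.
  by case: (boolP (_ \in D)) => // /(subsetP DD); rewrite inE /= pq eqxx.
apply/andP; split; apply/mem_Kclass; rewrite !uD1; first exact: GLa_equiv_refl.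
exact: WL_conjugate_equiv.
Qed.
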